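(* Let $\mathcal{H}$ be a finite-dimensional Hilbert space and let $\mathscr{A}\subseteq\mathfrak{B}(\mathcal{H})$ be a unital $*$-subalgebra with Wedderburn decomposition $\mathscr{A}=U\big(\bigoplus_{k}\mathfrak{B}(\mathcal{H}_{F,k})\otimes\mathbb{1}_{G,k}\big)U^\dagger$, and let $\check{\mathscr{A}}=\bigoplus_k\mathfrak{B}(\mathcal{H}_{F,k})$. For a choice of full-rank density operators $\tau_k$ on $\mathcal{H}_{G,k}$, let $\mathcal{R}:\mathfrak{B}(\mathcal{H})\to\check{\mathscr{A}}$ and $\mathcal{J}:\check{\mathscr{A}}\to\mathfrak{B}(\mathcal{H})$ be the CPTP maps $$\mathcal{R}(X)=\bigoplus_k \mathrm{tr}_{\mathcal{H}_{G,k}}(W_kXW_k^\dagger),\qquad \mathcal{J}\Big(\bigoplus_k X_k\Big)=U\Big(\bigoplus_k X_k\otimes\tau_k\Big)U^\dagger,$$ so that $\mathcal{J}\mathcal{R}$ is the state extension (dual of the conditional expectation) onto $\mathscr{A}$ associated with the $\tau_k$. Then for every Lindblad generator $\mathcal{L}$ on $\mathfrak{B}(\mathcal{H})$, the reduced map $\check{\mathcal{L}}\equiv\mathcal{R}\mathcal{L}\mathcal{J}$ is again a Lindblad generator: $\check{\mathcal{L}}$ maps $\check{\mathscr{A}}$ into $\check{\mathscr{A}}$ and $\{e^{\check{\mathcal{L}}t}\}_{t\ge0}$ is a quantum dynamical semigroup (a continuous one-parameter semigroup of completely positive trace-preserving maps) on $\check{\mathscr{A}}$.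
   Context: A Lindblad generator on $\mathfrak{B}(\mathcal{H})$ is a linear map of the form $\mathcal{L}(\rho)=-i[H,\rho]+\sum_u\big(L_u\rho L_u^\dagger-\tfrac12\{L_u^\dagger L_u,\rho\}\big)$ with $H=H^\dagger$ and arbitrary operators $L_u$. Wedderburn decomposition: $U$ is a unitary on $\mathcal{H}$ with $\mathcal{H}\cong U\big(\bigoplus_k\mathcal{H}_{F,k}\otimes\mathcal{H}_{G,k}\big)$. $W_k=P_kU^\dagger$, where $P_k$ is the co-isometry from $\bigoplus_j\mathcal{H}_{F,j}\otimes\mathcal{H}_{G,j}$ onto its $k$-th summand, so $W_kW_k^\dagger=\mathbb{1}_{F,k}\otimes\mathbb{1}_{G,k}$. $\check{\mathscr{A}}$ is the algebra of block-diagonal operators on $\bigoplus_k\mathcal{H}_{F,k}$. *)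

(* Defs.v *)
(* MathComp + mathcomp-real-closed (complex numbers R[i],
   Kronecker product) + MathComp-Analysis (limits, continuity). *)
From HB Require Import structures.
From mathcomp Require Import all_boot all_order all_algebra.
From mathcomp Require Import complex mxtens.
From mathcomp Require Import all_classical all_reals all_analysis.
Import GRing.Theory Num.Theory numFieldNormedType.Exports.
Unset Printing Implicit Defensive.
Local Open Scope ring_scope.
Local Open Scope complex_scope.
Local Open Scope classical_set_scope.

(* Conjugate transpose (Hermitian adjoint) of a complex matrix. *)
Definition adjmx {R : rcfType} {m n : nat} (M : 'M[R[i]]_(m, n)) : 'M[R[i]]_(n, m) :=
  (map_mx (fun z => z^*) M)^T.

(* Positive semidefinite operator on C^n. *)
Definition qpsd {R : rcfType} {n : nat} (M : 'M[R[i]]_n) : Prop :=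
  forall v : 'cV[R[i]]_n, 0 <= (adjmx v *m M *m v) 0 0.

Definition qhermitian {R : rcfType} {n : nat} (M : 'M[R[i]]_n) : Prop := adjmx M = M.

Definition qunitary {R : rcfType} {n : nat} (U : 'M[R[i]]_n) : Prop :=
  adjmx U *m U = 1%:M /\ U *m adjmx U = 1%:M.

(* Full-rank density operator: positive, trace one, invertible. *)
Definition full_rank_density {R : rcfType} {n : nat} (T : 'M[R[i]]_n) : Prop :=
  qpsd T /\ \tr T = 1 /\ T \in unitmx.

(* The Lindblad generator
   L(X) = -i[H,X] + sum_u (L_u X L_u^+ - 1/2 {L_u^+ L_u, X}). *)
Definition lindblad {R : rcfType} {n m : nat} (H : 'M[R[i]]_n)
  (Ls : 'I_m -> 'M[R[i]]_n) (X : 'M[R[i]]_n) : 'M[R[i]]_n :=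
  (- 'i) *: (H *m X - X *m H)
  + \sum_(u < m) (Ls u *m X *m adjmx (Ls u)
                   - 2^-1 *: (adjmx (Ls u) *m Ls u *m X + X *m (adjmx (Ls u) *m Ls u))).

(* Partial trace over the second tensor factor, with the index convention
   of the Kronecker product [tensmx] ( *t ). *)
Definition ptrace2 {R : rcfType} {a b : nat} (X : 'M[R[i]]_(a * b)) : 'M[R[i]]_a :=
  \matrix_(i, j) \sum_(l < b) X (mxtens_index (i, l)) (mxtens_index (j, l)).

(* Wedderburn data: blocks k < K, H_{F,k} = C^(dF k), H_{G,k} = C^(dG k);
   H = C^(\sum_k dF k * dG k) (up to the qunitary U);
   check-A lives in B(C^(\sum_k dF k)) as the block-diagonal operators. *)

(* The algebra check-A = (+)_k B(H_{F,k}) : block-diagonal matrices. *)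
Definition checkA {R : rcfType} {K : nat} (dF : 'I_K -> nat)
  (Y : 'M[R[i]]_(\sum_(k < K) dF k)) : Prop :=
  Y = mxdiag (fun k : 'I_K => @submxblock _ K K dF dF Y k k).

(* R(X) = (+)_k tr_{G,k} (W_k X W_k^+),  W_k = P_k U^+ . *)
Definition Rmap {R : rcfType} {K : nat} (dF dG : 'I_K -> nat)
  (U : 'M[R[i]]_(\sum_(k < K) dF k * dG k))
  (X : 'M[R[i]]_(\sum_(k < K) dF k * dG k)) : 'M[R[i]]_(\sum_(k < K) dF k) :=
  mxdiag (fun k : 'I_K => ptrace2
    (@submxblock _ K K (fun k => dF k * dG k) (fun k => dF k * dG k)
       (adjmx U *m X *m U) k k)).

(* J((+)_k X_k) = U ((+)_k X_k (x) tau_k) U^+ . *)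
Definition Jmap {R : rcfType} {K : nat} (dF dG : 'I_K -> nat)
  (U : 'M[R[i]]_(\sum_(k < K) dF k * dG k))
  (tau : forall k : 'I_K, 'M[R[i]]_(dG k))
  (Y : 'M[R[i]]_(\sum_(k < K) dF k)) : 'M[R[i]]_(\sum_(k < K) dF k * dG k) :=
  U *m mxdiag (fun k : 'I_K => @submxblock _ K K dF dF Y k k *t tau k) *m adjmx U.

(* 'M[R[i]]_p seen as a normed space over R[i] (this carries the usual
   norm topology used for limits and continuity below). *)
Definition cmxN (R : realType) (p : nat) : normedModType R[i] := 'M[R[i]]_p.

(* Matrix exponential  exp(A) = sum_k A^k / k!  (limit of partial sums). *)
Definition expmx {R : realType} {p : nat} (A : 'M[R[i]]_p) : 'M[R[i]]_p :=
  limn (series (fun k : nat => ((k`!%:R)^-1 *: A ^+ k : cmxN R p))).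

(* exp(t S) for a linear map S on 'M_(D), via its matrix [lin_mx S]
   acting on row-vectorized matrices. *)
Definition exp_superop {R : realType} {D : nat}
  (S : 'M[R[i]]_D -> 'M[R[i]]_D) (t : R) (X : 'M[R[i]]_D) : 'M[R[i]]_D :=
  vec_mx (mxvec X *m expmx ((t%:C : R[i]) *: lin_mx S)).

(* Complete positivity of Phi on the *-subalgebra described by P:
   Phi (x) id_m maps positive elements of M_m(P) to positive elements. *)
Definition cp_on {R : rcfType} {D : nat} (P : 'M[R[i]]_D -> Prop)
  (Phi : 'M[R[i]]_D -> 'M[R[i]]_D) : Prop :=
  forall (m : nat) (Xs : 'I_m -> 'I_m -> 'M[R[i]]_D),
    (forall a b, P (Xs a b)) ->
    qpsd (mxblock (fun a b : 'I_m => Xs a b)) ->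
    qpsd (mxblock (fun a b : 'I_m => Phi (Xs a b))).

Definition tp_on {R : rcfType} {D : nat} (P : 'M[R[i]]_D -> Prop)
  (Phi : 'M[R[i]]_D -> 'M[R[i]]_D) : Prop :=
  forall X, P X -> \tr (Phi X) = \tr X.

(* Quantum dynamical semigroup on the algebra P: a continuous one-parameter
   semigroup (t >= 0) of completely positive trace-preserving maps of P. *)
Definition qds_on {R : realType} {D : nat} (P : 'M[R[i]]_D -> Prop)
  (T : R -> 'M[R[i]]_D -> 'M[R[i]]_D) : Prop :=
  [/\ (forall t X, 0 <= t -> P X -> P (T t X)),
      (forall X, P X -> T 0 X = X),
      (forall s t X, 0 <= s -> 0 <= t -> P X -> T (s + t) X = T s (T t X)),
      (forall X, P X -> {within [set t : R | 0 <= t], continuous (fun t => (T t X : cmxN R D))})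
    & (forall t, 0 <= t -> cp_on P (T t) /\ tp_on P (T t))].

(* Main.v *)
(** Write [G = - i H - 1/2 \sum_u L_u^* L_u], so that
    [L X = G X + X G^* + \sum_u L_u X L_u^*].  For [h >= 0] the Kraus map
    [X |-> (1 + h G) X (1 + h G)^* + h \sum_u L_u X L_u^*] equals
    [X + h L X + h^2 G X G^*].  Sandwiching it between the completely positive
    maps [J] and [R], and using [R J = id] on the block-diagonal algebra, gives
    completely positive maps [T_h = id + h Lc + O(h^2)] of that algebra, and
    [exp (t Lc) = lim_n T_(t / n)^n] is completely positive as a limit of such
    maps.  The block-diagonal algebra is preserved and the trace is conserved
    because the corresponding linear maps [Y |-> diag Y - Y] and [tr] vanish on
    the range of [Lc].

    The exponential is controlled through the entrywise l1 norm [nu]: a power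
    series in [A] with nonnegative coefficients is dominated by the same series
    at [nu A], which reduces the semigroup law and all error estimates to facts
    about the real exponential. *)
Require Import Defs.
From HB Require Import structures.
From mathcomp Require Import all_boot all_order all_algebra.
From mathcomp Require Import complex mxtens.
From mathcomp Require Import all_classical all_reals all_analysis.
From mathcomp Require Import lra ring.
Import Order.TTheory GRing.Theory Num.Theory numFieldNormedType.Exports.
Import ComplexField.Normc.
Local Open Scope ring_scope.
Local Open Scope complex_scope.
Local Open Scope classical_set_scope.

(** * The entrywise l1 norm of complex matrices *)

Section EntrywiseNorm.
Context {R : rcfType}.

Lemma normc_norm (z : R[i]) : `|z| = (normc z)%:C.
Proof. by case: z. Qed.

Lemma normc_ge0 (z : R[i]) : 0 <= normc z.
Proof. by case: z => a b; exact: sqrtr_ge0. Qed.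

Lemma normc_real (x : R) : normc (x%:C) = `|x|.
Proof. by rewrite /normc /= expr0n addr0 sqrtr_sqr. Qed.

Lemma normr_Re_le (z : R[i]) : `|complex.Re z| <= normc z.
Proof.
by case: z => a b; rewrite /= -sqrtr_sqr ler_wsqrtr // lerDl sqr_ge0.
Qed.

Lemma normr_Im_le (z : R[i]) : `|complex.Im z| <= normc z.
Proof.
by case: z => a b; rewrite /= -sqrtr_sqr ler_wsqrtr // lerDr sqr_ge0.
Qed.

Lemma normc_le_ReIm (z : R[i]) : normc z <= `|complex.Re z| + `|complex.Im z|.
Proof.
case: z => a b /=.
have ab0 : 0 <= `|a| + `|b| by rewrite addr_ge0.
rewrite -[leRHS](ger0_norm ab0) -[leRHS]sqrtr_sqr ler_wsqrtr //.
by rewrite sqrrD !real_normK ?num_real // lerD2r lerDl mulrn_wge0 // mulr_ge0.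
Qed.

Lemma normc_sum I (r : seq I) (P : pred I) (F : I -> R[i]) :
  normc (\sum_(i <- r | P i) F i) <= \sum_(i <- r | P i) normc (F i).
Proof.
elim/big_rec2: _ => [|i y x _ le_xy]; first by rewrite normc0.
by apply: le_trans (le_normcD _ _) _; rewrite lerD2l.
Qed.

(** A real-valued norm, submultiplicative across rectangular shapes. It takes the value [p] on the
    identity of size [p], which explains the factors [nu 1%:M] in later bounds. *)
Definition nu {m n} (M : 'M[R[i]]_(m, n)) : R := \sum_i \sum_j normc (M i j).

Lemma nu_ge0 {m n} (M : 'M[R[i]]_(m, n)) : 0 <= nu M.
Proof. by do 2!apply: sumr_ge0 => ? _; exact: normc_ge0. Qed.

Lemma normc_entry_le {m n} (M : 'M[R[i]]_(m, n)) i j : normc (M i j) <= nu M.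
Proof.
rewrite /nu (bigD1 i) //= (bigD1 j) //= -addrA lerDl addr_ge0 //.
  by apply: sumr_ge0 => ? _; exact: normc_ge0.
by do 2!apply: sumr_ge0 => ? _; exact: normc_ge0.
Qed.

Lemma nu_le0_eq0 {m n} (M : 'M[R[i]]_(m, n)) : nu M <= 0 -> M = 0.
Proof.
move=> M0; apply/matrixP=> i j; rewrite mxE; apply: eq0_normc.
by apply: le_anti; rewrite normc_ge0 (le_trans (normc_entry_le M i j)).
Qed.

Lemma nu0 {m n} : nu (0 : 'M[R[i]]_(m, n)) = 0.
Proof. by rewrite /nu big1 // => i _; rewrite big1 // => j _; rewrite mxE normc0. Qed.

Lemma nuD {m n} (A B : 'M[R[i]]_(m, n)) : nu (A + B) <= nu A + nu B.
Proof.
rewrite /nu -big_split; apply: ler_sum => i _ /=.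
by rewrite -big_split; apply: ler_sum => j _; rewrite mxE le_normcD.
Qed.

Lemma nuZ {m n} c (A : 'M[R[i]]_(m, n)) : nu (c *: A) = normc c * nu A.
Proof.
rewrite /nu mulr_sumr; apply: eq_bigr => i _.
by rewrite mulr_sumr; apply: eq_bigr => j _; rewrite mxE normcM.
Qed.

Lemma nuN {m n} (A : 'M[R[i]]_(m, n)) : nu (- A) = nu A.
Proof.
by rewrite /nu; do 2!apply: eq_bigr => ? _; rewrite mxE normcN.
Qed.

Lemma nu_distC {m n} (A B : 'M[R[i]]_(m, n)) : nu (A - B) = nu (B - A).
Proof. by rewrite -nuN opprB. Qed.

Lemma nu_sum {m n} I (r : seq I) (P : pred I) (F : I -> 'M[R[i]]_(m, n)) :
  nu (\sum_(i <- r | P i) F i) <= \sum_(i <- r | P i) nu (F i).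
Proof.
elim/big_rec2: _ => [|i y x _ le_xy]; first by rewrite nu0.
by apply: le_trans (nuD _ _) _; rewrite lerD2l.
Qed.

Lemma nuM {m n p} (A : 'M[R[i]]_(m, n)) (B : 'M[R[i]]_(n, p)) :
  nu (A *m B) <= nu A * nu B.
Proof.
rewrite /nu mulr_suml; apply: ler_sum => i _.
rewrite mulr_suml.
apply: (@le_trans _ _ (\sum_j \sum_k normc (A i k) * normc (B k j))).
  apply: ler_sum => j _; rewrite mxE; apply: le_trans (normc_sum _ _ _ _) _.
  by apply: ler_sum => k _; rewrite normcM.
rewrite exchange_big; apply: ler_sum => k _.
rewrite -mulr_sumr ler_wpM2l ?normc_ge0 //.
rewrite [leRHS](bigD1 k) //= lerDl.
by do 2!apply: sumr_ge0 => ? _; exact: normc_ge0.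
Qed.

(** The left factor [C] absorbs the case [k = 0]: without it the bound by [nu A ^+ k] would fail for
    the identity as soon as [p > 1]. *)
Lemma nuMexp {p} (C A : 'M[R[i]]_p) k : nu (C *m A ^+ k) <= nu C * nu A ^+ k.
Proof.
elim: k => [|k IH]; first by rewrite !expr0 mulmx1 mulr1.
rewrite !exprSr mulmxA mulrA; apply: le_trans (nuM _ _) _.
by rewrite ler_wpM2r ?nu_ge0.
Qed.

Lemma nuX {p} (A : 'M[R[i]]_p) k : nu (A ^+ k) <= nu (1%:M : 'M[R[i]]_p) * nu A ^+ k.
Proof. by rewrite -[A ^+ k]mul1mx nuMexp. Qed.

(** Splitting off one factor [1 + A] at a time keeps the base at [1 + nu A]. Submultiplicativity
    alone gives [p + nu A], whose powers are not uniformly bounded along the Euler products when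
    [p > 1]. *)
Lemma nu_add1X_le {p} (A : 'M[R[i]]_p) k :
  nu ((1 + A) ^+ k) <= nu (1%:M : 'M[R[i]]_p) * (1 + nu A) ^+ k.
Proof.
elim: k => [|k IH]; first by rewrite !expr0 mulr1.
rewrite !exprSr mulrA mulrDr mulr1 (le_trans (nuD _ _)) //.
rewrite [leRHS]mulrDr mulr1 lerD // (le_trans (nuM _ _)) //.
by rewrite ler_wpM2r ?nu_ge0.
Qed.

(* Telescoping [B^n - C^n = \sum_j B^j (B - C) C^(n-1-j)]. *)
Lemma nu_subX {p} (B C : 'M[R[i]]_p) (b c : R) n :
  (forall j, (j <= n)%N -> nu (B ^+ j) <= b) ->
  (forall j, (j <= n)%N -> nu (C ^+ j) <= c) ->
  nu (B ^+ n - C ^+ n) <= n%:R * (b * nu (B - C) * c).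
Proof.
move=> hB hC; have b0 := le_trans (nu_ge0 _) (hB 0 (leq0n n)).
have c0 := le_trans (nu_ge0 _) (hC 0 (leq0n n)).
have -> : B ^+ n - C ^+ n = \sum_(j < n) B ^+ j * (B - C) * C ^+ (n.-1 - j).
  elim: n {hB hC} => [|n IH]; first by rewrite big_ord0 subrr.
  rewrite big_ord_recr /= subnn expr0 mulr1.
  rewrite (eq_bigr (fun j : 'I_n => B ^+ j * (B - C) * C ^+ (n.-1 - j) * C)).
    by rewrite -mulr_suml -IH mulrBl mulrBr -!exprSr addrC addrA subrK.
  move=> j _; rewrite -[RHS]mulrA -exprSr; congr (_ * C ^+ _).
  by rewrite -predn_sub prednK // subn_gt0.
apply: le_trans (nu_sum _ _ _ _) _.
rewrite mulr_natl -[X in _ *+ X]card_ord -sumr_const; apply: ler_sum => j _.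
apply: le_trans (nuM _ _) _; apply: ler_pM; rewrite ?nu_ge0 //.
  apply: le_trans (nuM _ _) _; rewrite ler_wpM2r ?nu_ge0 // hB //.
  exact: ltnW.
by apply: hC; rewrite (leq_trans (leq_subr _ _)) ?leq_pred.
Qed.

End EntrywiseNorm.

(** * Convergence of matrices measured by [nu] *)

Section NuLimits.
Context {R : realType}.

(** Bridge from real estimates on [nu] to the topology of [cmxN], in which the exponential and
    continuity are stated. *)
Lemma nu_cvg_cmxN {T : Type} {F : set_system T} {FF : Filter F} {p : nat}
    {f : T -> 'M[R[i]]_p} {l : 'M[R[i]]_p} :
  nu (f x - l) @[x --> F] --> (0 : R) ->
  (f x : cmxN R p) @[x --> F] --> (l : cmxN R p).
Proof.
move=> fl; apply/cvgrPdist_lt => e e0.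
(* A positive element of [R[i]] is real, so the radius [e] comes from some [d : R]. *)
have [d dE] : exists d : R, e = d%:C.
  by exists (complex.Re e); rewrite RRe_real // gtr0_real.
have d0 : 0 < d by move: e0; rewrite dE ltcR.
move/cvgrPdist_lt: fl => /(_ d d0); apply: filterS => x.
rewrite sub0r normrN ger0_norm ?nu_ge0 // => fd.
have : ball (l : cmxN R p) e (f x).
  split=> // i j; rewrite /ball /= /ball_ /= normc_norm dE ltcR.
  rewrite (le_lt_trans _ fd) // nu_distC.
  by rewrite (le_trans _ (normc_entry_le _ i j)) // !mxE.
by rewrite -ball_normE.
Qed.

Lemma nu_limn {p : nat} {f : nat -> 'M[R[i]]_p} {l : 'M[R[i]]_p} :
  nu (f n - l) @[n --> \oo] --> (0 : R) -> limn (f : nat -> cmxN R p) = l.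
Proof. by move=> /nu_cvg_cmxN fl; apply/cvg_lim => //; exact: norm_hausdorff. Qed.

(** Passes to the limit in [nu l <= nu (f k - l) + nu (f k)]. *)
Lemma nu_lim_le {m n : nat} {f : nat -> 'M[R[i]]_(m, n)} {l : 'M[R[i]]_(m, n)}
    {g : nat -> R} {c : R} :
  nu (f k - l) @[k --> \oo] --> (0 : R) -> (forall k, nu (f k) <= g k) ->
  g k @[k --> \oo] --> c -> nu l <= c.
Proof.
move=> fl fg gc; have gc' : nu (f k - l) + g k @[k --> \oo] --> c.
  by rewrite -[c]add0r; exact: cvgD.
apply: (cvgr_to_ge gc'); apply: nearW => k.
rewrite (le_trans _ (lerD (lexx _) (fg k))) // -[X in nu X <= _](subKr (f k)).
by rewrite addrC (le_trans (nuD _ _)) // nuN.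
Qed.

Lemma nu_cvg_squeeze {T : Type} {F : set_system T} {FF : Filter F} {m n : nat}
    (f : T -> 'M[R[i]]_(m, n)) (g : T -> R) :
  (\forall x \near F, nu (f x) <= g x) -> g x @[x --> F] --> (0 : R) ->
  nu (f x) @[x --> F] --> (0 : R).
Proof.
move=> fg g0; apply: (squeeze_cvgr _ (cvg_cst 0) g0).
by apply: filterS fg => x ->; rewrite nu_ge0.
Qed.

Lemma nu_cvg_unique {m n : nat} {f : nat -> 'M[R[i]]_(m, n)} {l l' : 'M[R[i]]_(m, n)} :
  nu (f k - l) @[k --> \oo] --> (0 : R) -> nu (f k - l') @[k --> \oo] --> (0 : R) ->
  l = l'.
Proof.
move=> fl fl'; apply/eqP; rewrite -subr_eq0; apply/eqP/nu_le0_eq0.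
have ll : nu (f k - l) + nu (f k - l') @[k --> \oo] --> (0 : R).
  by rewrite -[0]addr0; exact: cvgD.
apply: (cvgr_to_ge ll); apply: nearW => k.
rewrite -[X in nu X](subrKA (f k)) (le_trans (nuD _ _)) //.
by rewrite nu_distC lerD2l nu_distC.
Qed.

Lemma nu_cvgM {m n p : nat} {f : nat -> 'M[R[i]]_(m, n)} {g : nat -> 'M[R[i]]_(n, p)} {F G} :
  nu (f k - F) @[k --> \oo] --> (0 : R) -> nu (g k - G) @[k --> \oo] --> (0 : R) ->
  nu (f k *m g k - F *m G) @[k --> \oo] --> (0 : R).
Proof.
move=> fF gG.
apply: (@nu_cvg_squeeze _ _ _ _ _ _ (fun k =>
  nu (f k - F) * nu (g k - G) + nu (f k - F) * nu G + nu F * nu (g k - G))).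
  apply: nearW => k.
  have -> : f k *m g k - F *m G =
      (f k - F) *m (g k - G) + (f k - F) *m G + F *m (g k - G).
    by rewrite -mulmxDr subrK mulmxBl mulmxBr addrA subrK.
  do 2!(rewrite (le_trans (nuD _ _)) // lerD ?nuM //).
rewrite (_ : 0 = 0 * 0 + 0 * nu G + nu F * 0); last by ring.
by apply: cvgD; [apply: cvgD|]; apply: cvgM => //; exact: cvg_cst.
Qed.

End NuLimits.

(** * The matrix exponential: majorants, semigroup law and Euler products *)

Section MatrixExponential.
Context {R : realType}.

Lemma expR_cvg (x : R) : series (exp_coeff x) n @[n --> \oo] --> expR x.
Proof. exact: is_cvg_series_exp_coeff. Qed.

Lemma normc_invfact k : normc ((k`!%:R)^-1 : R[i]) = (k`!%:R)^-1.
Proof.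
rewrite normcV -(rmorph_nat (real_complex R)) normc_real ger0_norm //.
Qed.

Definition exp_psum {p} (A : 'M[R[i]]_p) (N : nat) : 'M[R[i]]_p :=
  \sum_(k < N) (k`!%:R)^-1 *: A ^+ k.

(** The real and imaginary parts of each entry form real series dominated by the exponential series
    at [nu A], so they converge absolutely; the limit matrix is assembled from their sums. *)
Lemma exp_psum_cvg_ex {p} (A : 'M[R[i]]_p) :
  exists E, nu (exp_psum A N - E) @[N --> \oo] --> (0 : R).
Proof.
pose u k : 'M[R[i]]_p := (k`!%:R)^-1 *: A ^+ k.
have uE i j k : normc (u k i j) <= nu (1%:M : 'M[R[i]]_p) * exp_coeff (nu A) k.
  rewrite (le_trans (normc_entry_le _ _ _)) // nuZ normc_invfact /exp_coeff /=.
  by rewrite mulrC mulrA ler_wpM2r ?invr_ge0 // nuX.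
have dom : cvgn (series (fun k => nu (1%:M : 'M[R[i]]_p) * exp_coeff (nu A) k)).
  rewrite (_ : (fun _ => _) = nu (1%:M : 'M[R[i]]_p) *: exp_coeff (nu A)) //.
  by apply: is_cvg_seriesZ; exact: is_cvg_series_exp_coeff.
have cv (f : nat -> R) : (forall k, `|f k| <= nu (1%:M : 'M[R[i]]_p) * exp_coeff (nu A) k) ->
    cvgn (series f).
  move=> hf; apply: normed_cvg; apply: series_le_cvg dom => k.
  - exact: normr_ge0.
  - by rewrite mulr_ge0 ?exp_coeff_ge0 ?nu_ge0.
  - exact: hf.
have cvRe i j : cvgn (series (fun k => complex.Re (u k i j))).
  by apply: cv => k; rewrite (le_trans (normr_Re_le _)).
have cvIm i j : cvgn (series (fun k => complex.Im (u k i j))).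
  by apply: cv => k; rewrite (le_trans (normr_Im_le _)).
pose re i j := limn (series (fun k => complex.Re (u k i j))).
pose im i j := limn (series (fun k => complex.Im (u k i j))).
exists (\matrix_(i, j) (re i j +i* im i j)).
have ReE N i j : complex.Re ((exp_psum A N) i j) = series (fun k => complex.Re (u k i j)) N.
  by rewrite /exp_psum summxE raddf_sum seriesEord.
have ImE N i j : complex.Im ((exp_psum A N) i j) = series (fun k => complex.Im (u k i j)) N.
  by rewrite /exp_psum summxE raddf_sum seriesEord.
(* The limit 0 is written as a double sum of the limits of the summands, so that convergence can be
   checked term by term. *)
have E0 : (0 : R) = \sum_(i < p) \sum_(j < p) (`|re i j - re i j| + `|im i j - im i j|).
  by rewrite big1 // => i _; rewrite big1 // => j _; rewrite !subrr normr0 addr0.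
apply: (@nu_cvg_squeeze _ _ _ _ _ _ _ (fun N => \sum_(i < p) \sum_(j < p)
  (`|series (fun k => complex.Re (u k i j)) N - re i j| +
   `|series (fun k => complex.Im (u k i j)) N - im i j|))).
  apply: nearW => N; rewrite /nu; apply: ler_sum => i _; apply: ler_sum => j _.
  apply: le_trans (normc_le_ReIm _) _.
  by rewrite !mxE !raddfB /= ReE ImE.
rewrite [X in _ --> X]E0; apply: (@cvg_big R _ +%R 0 _ (@add_continuous R)) => i _.
apply: (@cvg_big R _ +%R 0 _ (@add_continuous R)) => j _.
by apply: cvgD; apply: cvg_norm; apply: cvgB; [exact: cvRe|exact: cvg_cst|exact: cvIm|exact: cvg_cst].
Qed.

Lemma expmx_cvg {p} (A : 'M[R[i]]_p) :
  nu (exp_psum A N - expmx A) @[N --> \oo] --> (0 : R).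
Proof.
have [E hE] := exp_psum_cvg_ex A; rewrite /expmx.
suff -> : limn (series (fun k => (k`!%:R)^-1 *: A ^+ k : cmxN R p)) = E by [].
by rewrite seriesEord; exact: nu_limn hE.
Qed.

(** Every term of the series after the constant one contains the factor [A *m C]. *)
Lemma expmx_mul_ker {p q} (A : 'M[R[i]]_p) (C : 'M[R[i]]_(p, q)) :
  A *m C = 0 -> expmx A *m C = C.
Proof.
move=> AC; have h := @nu_cvgM _ _ _ _ _ (fun=> C) _ C (expmx_cvg A).
have {h} h : nu (exp_psum A k *m C - expmx A *m C) @[k --> \oo] --> (0 : R).
  apply: h; rewrite subrr; rewrite nu0; exact: cvg_cst.
(* The empty partial sum lacks the constant term, so the sequence is constant only from index 1
   on. *)
apply: (nu_cvg_unique h); apply: cvg_near_cst; exists 1%N => // -[//|N] _ /=.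
rewrite /exp_psum big_ord_recl fact0 invr1 scale1r expr0 mulmxDl mul1mx.
rewrite mulmx_suml big1 ?addr0 ?subrr ?nu0 // => k _.
by rewrite exprSr -scalemxAl -mulmxA AC mulmx0 scaler0.
Qed.

(** Real coefficients allow sign conditions; the explicit sum also makes sense for [p = 0], and for
    [p > 0] it agrees with [horner_mx]. *)
Definition mxeval {p} (q : {poly R}) (A : 'M[R[i]]_p) : 'M[R[i]]_p :=
  \sum_(k < size q) (q`_k)%:C *: A ^+ k.

Lemma mxeval_wide {p} N (q : {poly R}) (A : 'M[R[i]]_p) : (size q <= N)%N ->
  mxeval q A = \sum_(k < N) (q`_k)%:C *: A ^+ k.
Proof.
move=> qN; rewrite /mxeval (big_ord_widen N (fun k => (q`_k)%:C *: A ^+ k)) //.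
rewrite big_mkcond; apply: eq_bigr => k _; case: ltnP => // qk.
by rewrite nth_default // rmorph0 scale0r.
Qed.

Lemma mxevalB {p} (q r : {poly R}) (A : 'M[R[i]]_p) :
  mxeval (q - r) A = mxeval q A - mxeval r A.
Proof.
pose N := maxn (size q) (size r).
rewrite !(@mxeval_wide _ N) ?leq_maxl ?leq_maxr //; last first.
  by rewrite (leq_trans (size_polyD _ _)) // size_polyN.
rewrite -sumrB; apply: eq_bigr => k _.
by rewrite coefB rmorphB scalerBl.
Qed.

Lemma mxevalM {p} (q r : {poly R}) (A : 'M[R[i]]_p) :
  mxeval (q * r) A = mxeval q A *m mxeval r A.
Proof.
case: p A => [|p] A; first by rewrite [LHS]flatmx0 [RHS]flatmx0.
suff H s : mxeval s A = horner_mx A (map_poly (real_complex R) s).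
  by rewrite !H !rmorphM.
rewrite -[in RHS](coefK s) poly_def /mxeval !raddf_sum /=; apply: eq_bigr => k _.
by rewrite map_polyZ map_polyXn linearZ /= rmorphXn /= horner_mx_X.
Qed.

Lemma nu_mxeval_le {p} (q : {poly R}) (A : 'M[R[i]]_p) : (forall k, 0 <= q`_k) ->
  nu (mxeval q A) <= nu (1%:M : 'M[R[i]]_p) * q.[nu A].
Proof.
move=> q0; rewrite horner_coef mulr_sumr (le_trans (nu_sum _ _ _ _)) //.
apply: ler_sum => k _; rewrite nuZ normc_real ger0_norm // mulrCA.
by rewrite ler_wpM2l // nuX.
Qed.

(* [exprZn] needs a nontrivial ring, which ['M_p] is not when [p = 0]. *)
Lemma scalemxX {p} (c : R[i]) (A : 'M[R[i]]_p) k : (c *: A) ^+ k = c ^+ k *: A ^+ k.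
Proof.
elim: k => [|k IH]; first by rewrite !expr0 scale1r.
by rewrite !exprSr IH -[_ * _]/(_ *m _) -scalemxAl -scalemxAr scalerA.
Qed.

(** The time [t] sits in the coefficients, so exponentials of one matrix at different times can be
    compared coefficient by coefficient. *)
Definition exp_poly (t : R) N : {poly R} := \poly_(k < N) (t ^+ k / k`!%:R).

Lemma mxeval_exp_poly {p} t N (A : 'M[R[i]]_p) :
  mxeval (exp_poly t N) A = exp_psum (t%:C *: A) N.
Proof.
rewrite (mxeval_wide _ _ _ (size_poly N _)) /exp_psum; apply: eq_bigr => k _.
rewrite coef_poly ltn_ord scalemxX scalerA; congr (_ *: _).
by rewrite rmorphM fmorphV rmorphXn rmorph_nat mulrC.
Qed.

Lemma horner_exp_poly t N a : (exp_poly t N).[a] = series (exp_coeff (t * a)) N.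
Proof.
rewrite horner_poly seriesEord; apply: eq_bigr => k _.
by rewrite /exp_coeff /= exprMn mulrAC.
Qed.

Lemma exp_poly_ge0 t N k : 0 <= t -> 0 <= (exp_poly t N)`_k.
Proof. by move=> t0; rewrite coef_poly; case: ifP => // _; rewrite divr_ge0 ?exprn_ge0. Qed.

(** Majorant principle in the limit. Applied to differences of polynomials whose coefficients stay
    nonnegative, it bounds a matrix error by the corresponding scalar error. *)
Lemma nu_mxeval_lim_le {p} {A E : 'M[R[i]]_p} {f : nat -> {poly R}} {c} :
  nu (mxeval (f N) A - E) @[N --> \oo] --> (0 : R) ->
  (forall N k, 0 <= (f N)`_k) -> (f N).[nu A] @[N --> \oo] --> c ->
  nu E <= nu (1%:M : 'M[R[i]]_p) * c.
Proof.
move=> fE f0 fc; apply: (@nu_lim_le _ _ _ _ _ (fun N => nu (1%:M : 'M[R[i]]_p) * (f N).[nu A]) _ fE).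
  by move=> N; exact: nu_mxeval_le.
by apply: cvgM fc; exact: cvg_cst.
Qed.

Lemma exp_poly_cvg {p} t (A : 'M[R[i]]_p) :
  nu (mxeval (exp_poly t N) A - expmx (t%:C *: A)) @[N --> \oo] --> (0 : R).
Proof.
have := expmx_cvg (t%:C *: A); apply: cvg_trans; apply: near_eq_cvg.
by apply: nearW => N; rewrite mxeval_exp_poly.
Qed.

Lemma horner_exp_poly_cvg t a : (exp_poly t N).[a] @[N --> \oo] --> expR (t * a).
Proof.
have := expR_cvg (t * a); apply: cvg_trans; apply: near_eq_cvg.
by apply: nearW => N; rewrite horner_exp_poly.
Qed.

Lemma nu_expmx_le {p} t (A : 'M[R[i]]_p) : 0 <= t ->
  nu (expmx (t%:C *: A)) <= nu (1%:M : 'M[R[i]]_p) * expR (t * nu A).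
Proof.
move=> t0; apply: (nu_mxeval_lim_le (exp_poly_cvg t A)) => [N k|].
  exact: exp_poly_ge0.
exact: horner_exp_poly_cvg.
Qed.

Lemma nu_cvgB {m n} {f g : nat -> 'M[R[i]]_(m, n)} {F G} :
  nu (f k - F) @[k --> \oo] --> (0 : R) -> nu (g k - G) @[k --> \oo] --> (0 : R) ->
  nu (f k - g k - (F - G)) @[k --> \oo] --> (0 : R).
Proof.
move=> fF gG; apply: (@nu_cvg_squeeze _ _ _ _ _ _ _ (fun k => nu (f k - F) + nu (g k - G))).
  apply: nearW => k; rewrite (_ : _ - (F - G) = (f k - F) - (g k - G)).
    by rewrite (le_trans (nuD _ _)) // nuN.
  by rewrite !opprB addrACA [RHS]addrACA [- F - _]addrC.
by rewrite -[0]addr0; exact: cvgD.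
Qed.

(** The difference of the two series has coefficients [(t ^+ k - s ^+ k) / k!], nonnegative because
    [0 <= s <= t]. *)
Lemma nu_expmx_sub_le {p} s t (A : 'M[R[i]]_p) : 0 <= s -> s <= t ->
  nu (expmx (t%:C *: A) - expmx (s%:C *: A)) <=
  nu (1%:M : 'M[R[i]]_p) * (expR (t * nu A) - expR (s * nu A)).
Proof.
move=> s0 st; have := nu_cvgB (exp_poly_cvg t A) (exp_poly_cvg s A).
under eq_fun do rewrite -mxevalB.
move=> h; apply: (nu_mxeval_lim_le h) => [N k|].
  rewrite coefB subr_ge0 !coef_poly; case: ifP => // _.
  by rewrite ler_wpM2r ?invr_ge0 // lerXn2r // nnegrE (le_trans s0).
under eq_fun do rewrite hornerD hornerN.
by apply: cvgB; exact: horner_exp_poly_cvg.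
Qed.

(** The product of the partial sums at [s] and [t] minus the partial sum at [s + t] has nonnegative
    coefficients, and its scalar majorant tends to 0 by the functional equation of [expR]. *)
Lemma expmxD {p} s t (A : 'M[R[i]]_p) : 0 <= s -> 0 <= t ->
  expmx ((s + t)%:C *: A) = expmx (s%:C *: A) *m expmx (t%:C *: A).
Proof.
move=> s0 t0; apply/eqP; rewrite eq_sym -subr_eq0; apply/eqP/nu_le0_eq0.
rewrite -(mulr0 (nu (1%:M : 'M[R[i]]_p))).
have := nu_cvgB (nu_cvgM (exp_poly_cvg s A) (exp_poly_cvg t A)) (exp_poly_cvg (s + t) A).
under eq_fun do rewrite -mxevalM -mxevalB.
move=> h; apply: (nu_mxeval_lim_le h) => [N k|].
  (* From degree [N] on only the product contributes, with nonnegative coefficients. *)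
  rewrite coefB subr_ge0 [in leLHS]coef_poly; case: ifP => kN; last first.
    by rewrite coefM sumr_ge0 // => j _; rewrite mulr_ge0 ?exp_poly_ge0.
  (* Below degree [N] the two coefficients are equal, by the binomial theorem. *)
  rewrite coefM exprDn mulr_suml le_eqVlt; apply/orP; left; apply/eqP.
  rewrite [LHS](reindex_inj rev_ord_inj) /=; apply: eq_bigr => j _.
  have jk : (j <= k)%N by rewrite -ltnS.
  rewrite !coef_poly (leq_ltn_trans jk kN) (leq_ltn_trans (leq_subr _ _) kN).
  rewrite subSS subKn // -(bin_fact jk) bin_sub //.
  rewrite bin_fact // mulrnAl -mulrnAr.
  have fn0 n : (n`!%:R : R) != 0 by rewrite pnatr_eq0 -lt0n fact_gt0.
  rewrite -(bin_fact jk) !natrM -[X in _ * X]mulr_natr.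
  have b0 : ('C(k, j)%:R : R) != 0 by rewrite pnatr_eq0 -lt0n bin_gt0.
  by field; rewrite b0 !fn0.
under eq_fun do rewrite hornerD hornerN hornerM.
rewrite -[0](subrr (expR ((s + t) * nu A))) {1}mulrDl expRD.
by apply: cvgB; [apply: cvgM|]; exact: horner_exp_poly_cvg.
Qed.

(** The inequality [expR x * (1 - x) <= 1], used once as it is and once multiplied by [x], adds up
    to the claim. *)
Lemma expR_sub1x_le (x : R) : 0 <= x -> expR x - (1 + x) <= x ^+ 2 * expR x.
Proof.
move=> x0; have e0 := expR_gt0 x.
have h : expR x * (1 - x) <= 1.
  rewrite -[leRHS](expRxMexpNx_1 x) ler_pM2l //; exact: expR_ge1Dx.
have h1 : x * (expR x * (1 - x)) <= x * 1 by rewrite ler_wpM2l.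
nra.
Qed.

Lemma nu_expmx_sub1_le {p} t (A : 'M[R[i]]_p) : 0 <= t ->
  nu (expmx (t%:C *: A) - (1 + t%:C *: A)) <=
  nu (1%:M : 'M[R[i]]_p) * ((t * nu A) ^+ 2 * expR (t * nu A)).
Proof.
move=> t0; apply: (@le_trans _ _
  (nu (1%:M : 'M[R[i]]_p) * (expR (t * nu A) - (1 + t * nu A)))); last first.
  by rewrite ler_wpM2l ?nu_ge0 // expR_sub1x_le // mulr_ge0 ?nu_ge0.
have lin : mxeval (1 + t *: 'X) A = 1 + t%:C *: A.
  rewrite (@mxeval_wide _ 2); last first.
    rewrite (leq_trans (size_polyD _ _)) // size_poly1 geq_max /=.
    by rewrite (leq_trans (size_scale_leq _ _)) ?size_polyX.
  rewrite !big_ord_recl big_ord0 /= !coefE /= !mulr0 !addr0 !add0r mulr1.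
  by rewrite expr0 expr1 scale1r.
(* The shift by 2 puts the terms of degree 0 and 1 in every partial sum, so that subtracting
   [1 + t *: 'X] leaves nonnegative coefficients. *)
have sh : nu (mxeval (exp_poly t (N + 2)) A - expmx (t%:C *: A)) @[N --> \oo] --> (0 : R).
  by have := exp_poly_cvg t A; rewrite -(cvg_shiftn 2).
have one : nu (mxeval (1 + t *: 'X) A - (1 + t%:C *: A)) @[N --> \oo] --> (0 : R).
  by rewrite lin subrr nu0; exact: cvg_cst.
have := nu_cvgB sh one; under eq_fun do rewrite -mxevalB.
move=> h; apply: (nu_mxeval_lim_le h) => [N k|].
  rewrite coefB subr_ge0 coef_poly !coefE.
  case: k => [|[|k]] /=; rewrite ?addn2 ?ltnS /=.
  - by rewrite mulr0 addr0 expr0 fact0 divr1.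
  - by rewrite expr1 add0r mulr1 divr1.
  - by rewrite mulr0 addr0; case: ifP => // _; rewrite divr_ge0 ?exprn_ge0.
under eq_fun do rewrite hornerD hornerN hornerD hornerZ hornerX hornerC.
apply: cvgB; last exact: cvg_cst.
by have := horner_exp_poly_cvg t (nu A); rewrite -(cvg_shiftn 2).
Qed.

Lemma expmx0 {p} : expmx (0 : 'M[R[i]]_p) = 1%:M.
Proof. by rewrite -[LHS]mulmx1 expmx_mul_ker // mul0mx. Qed.

Lemma expmxX {p} t (A : 'M[R[i]]_p) j : 0 <= t ->
  expmx (t%:C *: A) ^+ j = expmx ((t *+ j)%:C *: A).
Proof.
move=> t0; elim: j => [|j IH]; first by rewrite mulr0n scale0r expmx0.
by rewrite exprSr IH mulrSr expmxD // mulrn_wge0.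
Qed.

(** With step [h = t / n.+1], one Euler factor differs from [expmx (h%:C *: A)] by [O(h ^+ 2)], and
    powers of both stay bounded up to time [t]. Telescoping over [n.+1] steps leaves an error
    [O(1 / n.+1)]. *)
Lemma euler_cvg {p} (A B : 'M[R[i]]_p) t : 0 <= t ->
  nu ((1 + (t / n.+1%:R)%:C *: A + ((t / n.+1%:R) ^+ 2)%:C *: B) ^+ n.+1
      - expmx (t%:C *: A)) @[n --> \oo] --> (0 : R).
Proof.
move=> t0; pose c := nu (1%:M : 'M[R[i]]_p); pose a := nu A; pose b := nu B.
have [a0 b0 c0] : [/\ 0 <= a, 0 <= b & 0 <= c] by rewrite !nu_ge0.
(* In order: a bound on powers of the Euler factor, the local error constant, a bound on powers of
   the exponential, and [t ^+ 2] from [h ^+ 2]. *)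
pose kappa := c * expR (t * (a + t * b)) * (b + c * (a ^+ 2 * expR (t * a)))
  * (c * expR (t * a)) * t ^+ 2.
apply: (@nu_cvg_squeeze _ _ _ _ _ _ _ (fun n => kappa * n.+1%:R^-1)); last first.
  rewrite -(mulr0 kappa); apply: cvgM; first exact: cvg_cst.
  exact: cvg_harmonic.
apply: nearW => n; set h := t / _.
have n0 : (0 : R) < n.+1%:R by rewrite ltr0n.
have h0 : 0 <= h by rewrite divr_ge0.
have hn : h * n.+1%:R = t by rewrite /h divfK // lt0r_neq0.
have ht : h <= t by rewrite -hn ler_peMr // ler1n.
have hj j : (j <= n.+1)%N -> h *+ j <= t.
  by move=> jn; rewrite -hn -mulr_natr ler_wpM2l // ler_nat.
have -> : expmx (t%:C *: A) = expmx (h%:C *: A) ^+ n.+1.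
  by rewrite (expmxX _ _ _ h0) -mulr_natr hn.
apply: le_trans (@nu_subX _ _ _ _ (c * expR (t * (a + t * b))) (c * expR (t * a)) _ _ _) _.
- move=> j jn; rewrite -addrA (le_trans (nu_add1X_le _ _)) // ler_wpM2l //.
  set x := nu _.
  (* Uses [h <= t] in one factor of [h ^+ 2], so that the bound is linear in [h]. *)
  have xle : x <= h * (a + t * b).
    rewrite /x (le_trans (nuD _ _)) // !nuZ !normc_real !ger0_norm ?exprn_ge0 //.
    rewrite mulrDr lerD2l expr2 -mulrA ler_wpM2l // ler_wpM2r //.
  apply: (@le_trans _ _ (expR x ^+ j)).
    by rewrite lerXn2r ?nnegrE ?expR_ge0 ?expR_ge1Dx // addr_ge0 ?nu_ge0.
  rewrite -expRM_natl ler_expR; apply: (@le_trans _ _ ((h *+ j) * (a + t * b))).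
    by rewrite mulr_natl mulrnAl ler_wMn2r.
  by rewrite ler_wpM2r ?hj // addr_ge0 ?mulr_ge0.
- move=> j jn; rewrite (expmxX _ _ _ h0) (le_trans (nu_expmx_le _ _ (mulrn_wge0 _ h0))) //.
  by rewrite ler_wpM2l // ler_expR ler_wpM2r // hj.
(* Local error: [b] comes from the term in [B], the rest from the second-order remainder of the
   exponential. *)
have stepE : nu (1 + h%:C *: A + (h ^+ 2)%:C *: B - expmx (h%:C *: A)) <=
    (b + c * (a ^+ 2 * expR (t * a))) * h ^+ 2.
  rewrite addrAC addrC (le_trans (nuD _ _)) //.
  rewrite nuZ normc_real ger0_norm ?exprn_ge0 // mulrDl lerD // ?[b * _]mulrC //.
  rewrite nu_distC (le_trans (nu_expmx_sub1_le _ _ h0)) //.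
  rewrite -mulrA ler_wpM2l // exprMn -/a.
  have he : expR (h * a) <= expR (t * a) by rewrite ler_expR ler_wpM2r.
  have := ler_wpM2l (mulr_ge0 (sqr_ge0 h) (sqr_ge0 a)) he; lra.
have kE : kappa / n.+1%:R = n.+1%:R * (c * expR (t * (a + t * b))
    * ((b + c * (a ^+ 2 * expR (t * a))) * h ^+ 2) * (c * expR (t * a))).
  by rewrite /kappa -hn; field; rewrite lt0r_neq0.
rewrite kE ler_pM2l // ler_wpM2r ?mulr_ge0 ?expR_ge0 //.
by rewrite ler_wpM2l ?mulr_ge0 ?expR_ge0.
Qed.

End MatrixExponential.

(** * Exponentials of linear maps on matrices *)

Section SuperoperatorExponential.
Context {R : realType} {D : nat}.
Implicit Types (S : 'M[R[i]]_D -> 'M[R[i]]_D) (X : 'M[R[i]]_D).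

Lemma mul_mxvec_lin_mx {a b c d : nat} (f : 'M[R[i]]_(a, b) -> 'M[R[i]]_(c, d)) Y :
  linear f -> mxvec Y *m lin_mx f = mxvec (f Y).
Proof.
move=> lf; pose g : {linear 'M[R[i]]_(a, b) -> 'M[R[i]]_(c, d)} :=
  HB.pack f (GRing.isLinear.Build _ _ _ _ f lf).
exact: (mul_vec_lin g).
Qed.

Lemma nu_vec_mx {m n : nat} (v : 'rV[R[i]]_(m * n)) : nu (vec_mx v) = nu v.
Proof.
rewrite /nu big_ord_recl big_ord0 addr0 pair_big /=.
rewrite [RHS](reindex _ (curry_mxvec_bij m n)) /=.
by apply: eq_bigr => -[i j] _; rewrite mxE ord1.
Qed.

Lemma expR_dist_cvg0 (c a s : R) :
  c * `|expR (t * a) - expR (s * a)| @[t --> s] --> (0 : R).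
Proof.
have h : (expR (t * a) : R) @[t --> s] --> (expR (s * a) : R).
  apply: (@cvg_comp _ _ _ (fun t : R => t * a) expR _ (nbhs (s * a))).
    by apply: cvgM; [exact: cvg_id|exact: cvg_cst].
  exact: continuous_expR.
have h1 : (expR (t * a) - expR (s * a) : R) @[t --> s] --> (0 : R).
  by rewrite -(subrr (expR (s * a))); apply: cvgB => //; exact: cvg_cst.
have h2 : (`|expR (t * a) - expR (s * a)| : R) @[t --> s] --> (0 : R).
  by rewrite -(@normr0 _ R); exact: cvg_norm.
by rewrite -(mulr0 c); apply: cvgM => //; exact: cvg_cst.
Qed.

Lemma exp_superop_continuous S X :
  {within [set t : R | 0 <= t], continuous (fun t => (exp_superop S t X : cmxN R D))}.
Proof.
apply/subspace_continuousP => s s0.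
apply: nu_cvg_cmxN; rewrite /exp_superop; set A := lin_mx S.
pose c := nu (mxvec X) * nu (1%:M : 'M[R[i]]_(D * D)).
apply: (@nu_cvg_squeeze _ _ _ _ _ _ _
  (fun t => c * `|expR (t * nu A) - expR (s * nu A)|)).
  rewrite near_withinE; apply: nearW => t t0.
  rewrite -linearB nu_vec_mx -mulmxBr (le_trans (nuM _ _)) //.
  rewrite /c -mulrA ler_wpM2l ?nu_ge0 //.
  have e0 u v : u <= v -> 0 <= expR (v * nu A) - expR (u * nu A).
    by move=> uv; rewrite subr_ge0 ler_expR ler_wpM2r ?nu_ge0.
  (* The majorant estimate requires ordered times, hence one case on each side of [s]. *)
  have [st|/ltW ts] := leP s t.
    by rewrite ger0_norm ?e0 // nu_expmx_sub_le.
  by rewrite nu_distC distrC ger0_norm ?e0 // nu_expmx_sub_le.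
exact: (@cvg_within_filter _ _ _ _ _ _ _ (expR_dist_cvg0 c (nu A) s)).
Qed.

Lemma exp_superop0 S X : exp_superop S 0 X = X.
Proof. by rewrite /exp_superop scale0r expmx0 mulmx1 mxvecK. Qed.

Lemma exp_superopD S s t X : 0 <= s -> 0 <= t ->
  exp_superop S (s + t) X = exp_superop S s (exp_superop S t X).
Proof.
(* Matrices act on row vectors from the right, so the factor at [t], applied first, must stand on
   the left; [addrC] arranges this. *)
by move=> s0 t0; rewrite /exp_superop vec_mxK addrC expmxD // mulmxA.
Qed.

(** Since [lin_mx S *m lin_mx f = 0], only the constant term of the exponential series contributes.
    This serves both for invariance of the algebra and for trace preservation. *)
Lemma exp_superop_invariant {a b : nat} (f : 'M[R[i]]_D -> 'M[R[i]]_(a, b)) S t X :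
  linear S -> linear f -> (forall Y, f (S Y) = 0) -> f (exp_superop S t X) = f X.
Proof.
move=> lS lf fS0; apply: (can_inj mxvecK).
rewrite -[LHS](mul_mxvec_lin_mx _ _ lf) -[RHS](mul_mxvec_lin_mx _ _ lf) /exp_superop vec_mxK -mulmxA expmx_mul_ker //.
rewrite -scalemxAl (_ : _ *m _ = 0) ?scaler0 //.
apply/row_matrixP => i; rewrite row0 rowE -[delta_mx _ _]vec_mxK mulmxA.
by rewrite (mul_mxvec_lin_mx _ _ lS) (mul_mxvec_lin_mx _ _ lf) fS0 linear0.
Qed.

End SuperoperatorExponential.

(** * Adjoints and the spectral theory of positive matrices *)

Section Adjoint.
Context {R : rcfType}.

Lemma adjmxE {m n} (M : 'M[R[i]]_(m, n)) i j : adjmx M i j = (M j i)^*.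
Proof. by rewrite !mxE. Qed.

Lemma adjmxK {m n} (M : 'M[R[i]]_(m, n)) : adjmx (adjmx M) = M.
Proof. by apply/matrixP => i j; rewrite !adjmxE conjcK. Qed.

Lemma adjmxM {m n p} (A : 'M[R[i]]_(m, n)) (B : 'M[R[i]]_(n, p)) :
  adjmx (A *m B) = adjmx B *m adjmx A.
Proof. by rewrite /adjmx map_mxM trmx_mul. Qed.

Lemma adjmxD {m n} (A B : 'M[R[i]]_(m, n)) : adjmx (A + B) = adjmx A + adjmx B.
Proof. by rewrite /adjmx map_mxD linearD. Qed.

Lemma adjmxN {m n} (A : 'M[R[i]]_(m, n)) : adjmx (- A) = - adjmx A.
Proof. by rewrite /adjmx map_mxN linearN. Qed.

Lemma adjmxZ {m n} c (A : 'M[R[i]]_(m, n)) : adjmx (c *: A) = conjc c *: adjmx A.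
Proof. by rewrite /adjmx map_mxZ linearZ. Qed.

Lemma adjmx1 {n} : adjmx (1%:M : 'M[R[i]]_n) = 1%:M.
Proof. by rewrite /adjmx map_mx1 trmx1. Qed.

Lemma adjmx_sum {m n} I (r : seq I) (P : pred I) (F : I -> 'M[R[i]]_(m, n)) :
  adjmx (\sum_(i <- r | P i) F i) = \sum_(i <- r | P i) adjmx (F i).
Proof.
elim/big_rec2: _ => [|i x y _ <-]; last by rewrite adjmxD.
by rewrite /adjmx map_mx0 trmx0.
Qed.

Lemma adjmx_mxcol {p n} {p_ : 'I_p -> nat} (C_ : forall i, 'M[R[i]]_(p_ i, n)) :
  adjmx (mxcol C_) = mxrow (fun i => adjmx (C_ i)).
Proof. by apply/matrixP => i j; rewrite !mxE. Qed.

(** Expressing the eigenvalues as values of the quadratic form lets information on that form pass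
    directly to [D]. *)
Lemma normalmx_diagonalized {n} (A : 'M[R[i]]_n) : A *m adjmx A = adjmx A *m A ->
  exists P (D : 'rV[R[i]]_n),
    [/\ P *m adjmx P = 1%:M, A = adjmx P *m diag_mx D *m P
      & forall i, D 0 i = (adjmx (col i (adjmx P)) *m A *m col i (adjmx P)) 0 0].
Proof.
have tE m k (M : 'M[R[i]]_(m, k)) : adjmx M = (map_mx Num.conj M^T).
  by rewrite /adjmx map_trmx.
move=> AA; have nA : A \is normalmx by apply/normalmxP; rewrite -tE.
have uP := spectral_unitarymx A; set P := spectralmx A in uP *.
have PP : P *m adjmx P = 1%:M by rewrite tE; apply/unitarymxP.
move/orthomx_spectralP: nA; rewrite -/P (invmx_unitary uP) -tE => defA.
exists P, (spectral_diag A); split=> // i.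
rewrite {2}defA !mulmxA colE adjmxM adjmxK !mulmxA.
rewrite -[_ *m P *m adjmx P]mulmxA PP mulmx1.
rewrite -[_ *m P *m adjmx P]mulmxA PP mulmx1.
have -> : adjmx (delta_mx i 0 : 'cV[R[i]]_n) = delta_mx 0 i.
  by apply/matrixP => x y; rewrite adjmxE !mxE conjc_nat andbC.
by rewrite -colE -rowE !mxE eqxx.
Qed.

(** The matrix [adjmx M - M] is skew-adjoint, hence normal, and its quadratic form vanishes because
    that of [M] is real. Its eigenvalues are therefore all 0. *)
Lemma qpsd_adj {n} (M : 'M[R[i]]_n) : qpsd M -> adjmx M = M.
Proof.
move=> psdM; apply/eqP; rewrite -subr_eq0; apply/eqP; set N := _ - M.
have NN : adjmx N = - N by rewrite /N adjmxD adjmxN adjmxK opprB.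
have N0 (v : 'cV[R[i]]_n) : (adjmx v *m N *m v) 0 0 = 0.
  have -> : adjmx v *m N *m v = adjmx (adjmx v *m M *m v) - adjmx v *m M *m v.
    by rewrite !adjmxM adjmxK mulmxA -mulmxBl -mulmxBr.
  rewrite [LHS]mxE [X in _ + X]mxE adjmxE; apply/eqP; rewrite subr_eq0; apply/eqP/CrealP.
  by apply: ger0_real; exact: psdM.
have [|P [D [_ defN D0]]] := normalmx_diagonalized N; first by rewrite NN mulmxN mulNmx.
rewrite defN; have -> : D = 0 by apply/rowP => i; rewrite D0 N0 mxE.
by rewrite (_ : diag_mx 0 = 0) ?mulmx0 ?mul0mx //; apply/matrixP => i j; rewrite !mxE mul0rn.
Qed.

(** Take [B] to be the adjoint of the diagonalizing unitary times the square root of the diagonal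
    part. *)
Lemma qpsd_gram {n} (M : 'M[R[i]]_n) : qpsd M -> exists B : 'M[R[i]]_n, M = B *m adjmx B.
Proof.
move=> psdM; have [|P [D [_ defM D0]]] := normalmx_diagonalized M.
  by rewrite qpsd_adj.
pose s : 'rV[R[i]]_n := map_mx sqrtC D.
exists (adjmx P *m diag_mx s); rewrite adjmxM adjmxK mulmxA {1}defM; congr (_ *m _).
rewrite -mulmxA; congr (_ *m _).
have -> : adjmx (diag_mx s) = diag_mx s.
  apply/matrixP => i j; rewrite adjmxE !mxE; have [->|] := eqVneq i j.
    rewrite !mulr1n; apply: CrealP; apply: ger0_real; rewrite sqrtC_ge0.
    by rewrite D0; exact: psdM.
  by rewrite mulr0n => _; rewrite conjc0.
apply/matrixP => i j; rewrite mul_diag_mx !mxE; have [->|] := eqVneq i j.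
  by rewrite !mulr1n -expr2 sqrtCK.
by rewrite !mulr0n mulr0.
Qed.

End Adjoint.

(** * Completely positive maps built from Kraus forms *)

Section CompletePositivity.
Context {R : rcfType}.

(** The quadratic form of the block matrix [Xs] at the vector with blocks [w]. *)
Definition blockform {m n : nat} (Xs : 'I_m -> 'I_m -> 'M[R[i]]_n)
    (w : 'I_m -> 'cV[R[i]]_n) : R[i] :=
  \sum_a \sum_b (adjmx (w a) *m Xs a b *m w b) 0 0.

Lemma qpsd_mxblockP {m n : nat} (Xs : 'I_m -> 'I_m -> 'M[R[i]]_n) :
  qpsd (mxblock (fun a b : 'I_m => Xs a b)) <-> forall w, 0 <= blockform Xs w.
Proof.
have E w : (adjmx (mxcol w) *m mxblock (fun a b : 'I_m => Xs a b) *m mxcol w) 0 0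
    = blockform Xs w.
  rewrite adjmx_mxcol mul_mxrow_mxblock mul_mxrow_mxcol summxE /blockform exchange_big.
  by apply: eq_bigr => b _; rewrite mulmx_suml summxE.
split=> [h w|h v]; first by rewrite -E.
by rewrite -(submxcolK v) E.
Qed.

(** Complete positivity on full matrix algebras, with distinct source and target dimensions so that
    [Jmap] and [Rmap] can be composed. *)
Definition cpmap {p q : nat} (Phi : 'M[R[i]]_p -> 'M[R[i]]_q) : Prop :=
  forall (m : nat) (Xs : 'I_m -> 'I_m -> 'M[R[i]]_p),
    (forall w, 0 <= blockform Xs w) ->
    forall w, 0 <= blockform (fun a b => Phi (Xs a b)) w.

Lemma cpmap_comp {p q r : nat} (Phi : 'M[R[i]]_p -> 'M[R[i]]_q)
    (Psi : 'M[R[i]]_q -> 'M[R[i]]_r) :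
  cpmap Phi -> cpmap Psi -> cpmap (fun X => Psi (Phi X)).
Proof. by move=> cPhi cPsi m Xs h; apply: cPsi; exact: cPhi. Qed.

Lemma eq_cpmap {p q : nat} (Phi Psi : 'M[R[i]]_p -> 'M[R[i]]_q) :
  Phi =1 Psi -> cpmap Phi -> cpmap Psi.
Proof.
move=> e cPhi m Xs h w; have := cPhi m Xs h w.
by congr (0 <= _); do 2!apply: eq_bigr => ? _; rewrite e.
Qed.

Lemma cpmap_conj {p q : nat} (V : 'M[R[i]]_(q, p)) : cpmap (fun X => V *m X *m adjmx V).
Proof.
move=> m Xs h w; have := h (fun a => adjmx V *m w a).
by congr (0 <= _); do 2!apply: eq_bigr => ? _; rewrite adjmxM adjmxK !mulmxA.
Qed.

Lemma blockform_sum {m n : nat} I (r : seq I) (P : pred I)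
    (Xs : I -> 'I_m -> 'I_m -> 'M[R[i]]_n) w :
  blockform (fun a b => \sum_(k <- r | P k) Xs k a b) w
  = \sum_(k <- r | P k) blockform (Xs k) w.
Proof.
rewrite /blockform [RHS]exchange_big /=; apply: eq_bigr => a _.
rewrite [RHS]exchange_big /=; apply: eq_bigr => b _.
by rewrite mulmx_sumr mulmx_suml summxE.
Qed.

Lemma cpmap_sum {p q : nat} I (r : seq I) (P : pred I)
    (Phi : I -> 'M[R[i]]_p -> 'M[R[i]]_q) :
  (forall k, cpmap (Phi k)) -> cpmap (fun X => \sum_(k <- r | P k) Phi k X).
Proof.
move=> cPhi m Xs h w; rewrite blockform_sum; apply: sumr_ge0 => k _.
exact: cPhi.
Qed.

Lemma cpmapD {p q : nat} (Phi Psi : 'M[R[i]]_p -> 'M[R[i]]_q) :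
  cpmap Phi -> cpmap Psi -> cpmap (fun X => Phi X + Psi X).
Proof.
move=> cPhi cPsi; pose F (b : bool) := if b then Phi else Psi.
apply: (@eq_cpmap _ _ (fun X => \sum_(b : bool) F b X)) => [X|].
  by rewrite big_bool.
by apply: cpmap_sum => -[].
Qed.

Lemma cpmapZ {p q : nat} (c : R[i]) (Phi : 'M[R[i]]_p -> 'M[R[i]]_q) :
  0 <= c -> cpmap Phi -> cpmap (fun X => c *: Phi X).
Proof.
move=> c0 cPhi m Xs h w.
have -> : blockform (fun a b => c *: Phi (Xs a b)) w
    = c * blockform (fun a b => Phi (Xs a b)) w.
  rewrite /blockform mulr_sumr; apply: eq_bigr => a _.
  by rewrite mulr_sumr; apply: eq_bigr => b _; rewrite -scalemxAr -scalemxAl mxE.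
by rewrite mulr_ge0 ?cPhi.
Qed.

(** Selecting rows and columns is conjugation by a 0-1 matrix, so it is a Kraus map with one
    operator. *)
Lemma mxsub_conj {p q : nat} (f : 'I_q -> 'I_p) (X : 'M[R[i]]_p) :
  mxsub f f X = rowsub f 1%:M *m X *m adjmx (rowsub f 1%:M).
Proof.
apply/matrixP => i j; rewrite -rowsubE mxE mxE (bigD1 (f j)) //= big1.
  by rewrite adjmxE !mxE eqxx conjc1 mulr1 addr0.
by move=> k kj; rewrite adjmxE !mxE eq_sym (negPf kj) conjc0 mulr0.
Qed.

Lemma cpmap_mxsub {p q : nat} (f : 'I_q -> 'I_p) : cpmap (mxsub f f : 'M[R[i]]_p -> 'M[R[i]]_q).
Proof. by apply: eq_cpmap (cpmap_conj (rowsub f 1%:M)) => X; rewrite mxsub_conj. Qed.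

(** The quadratic form of a block-diagonal output is the sum of those of its blocks, and each block
    sees only a principal submatrix of the input. *)
Lemma cpmap_mxdiag {K : nat} (p q : 'I_K -> nat)
    (Phi : forall k, 'M[R[i]]_(p k) -> 'M[R[i]]_(q k)) :
  (forall k, cpmap (Phi k)) ->
  cpmap (fun Y : 'M[R[i]]_(\sum_k p k) => mxdiag (fun k => Phi k (submxblock Y k k))).
Proof.
move=> cPhi m Xs h w.
have -> : blockform (fun a b => mxdiag (fun k => Phi k (submxblock (Xs a b) k k))) w =
    \sum_k blockform (fun a b => Phi k (submxblock (Xs a b) k k)) (fun a => submxcol (w a) k).
  rewrite /blockform [RHS]exchange_big /=; apply: eq_bigr => a _.
  rewrite [RHS]exchange_big /=; apply: eq_bigr => b _.
  rewrite -{1}(submxcolK (w a)) -{1}(submxcolK (w b)) adjmx_mxcol.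
  by rewrite mul_mxrow_mxdiag mul_mxrow_mxcol summxE.
by apply: sumr_ge0 => k _; apply: cPhi; apply: cpmap_mxsub.
Qed.

Lemma ptrace2E {a b : nat} (X : 'M[R[i]]_(a * b)) :
  ptrace2 X = \sum_(l < b) mxsub (fun i => mxtens_index (i, l)) (fun i => mxtens_index (i, l)) X.
Proof.
by apply/matrixP => i j; rewrite summxE mxE; apply: eq_bigr => l _; rewrite !mxE.
Qed.

Lemma cpmap_ptrace2 {a b : nat} : cpmap (@ptrace2 R a b).
Proof.
apply: (@eq_cpmap _ _ _ _ (fun X => esym (ptrace2E X))).
by apply: cpmap_sum => l; exact: cpmap_mxsub.
Qed.

(** Kraus form with the isometries [adjmx V] sending [x] to [x] tensored with the [l]-th basis
    vector. The double adjoint keeps the shape of [cpmap_conj]. *)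
Lemma tens1E {a b : nat} (X : 'M[R[i]]_a) :
  X *t (1%:M : 'M[R[i]]_b) = \sum_(l < b)
    let V := rowsub (fun i => mxtens_index (i, l)) (1%:M : 'M[R[i]]_(a * b)) in
    adjmx V *m X *m adjmx (adjmx V).
Proof.
apply/matrixP => x y; case: (mxtens_indexP x) => i k; case: (mxtens_indexP y) => j l.
rewrite tensmxE summxE.
have vE l' i' i0 k0 : (rowsub (fun i => mxtens_index (i, l')) (1%:M : 'M[R[i]]_(a * b)))
    i' (mxtens_index (i0, k0)) = ((i' == i0) && (l' == k0))%:R.
  by rewrite !mxE (can_eq (@mxtens_indexK _ _)).
rewrite (bigD1 k) //= [X in _ + X]big1 ?addr0.
  rewrite adjmxK [RHS]mxE (bigD1 j) //= [X in _ + X]big1 ?addr0.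
    rewrite vE eqxx [X in _ = X * _]mxE (bigD1 i) //= [X in _ + X]big1 ?addr0.
      by rewrite adjmxE vE !eqxx conjc1 mul1r !mxE.
    by move=> i' ii; rewrite adjmxE vE (negPf ii) conjc0 mul0r.
  by move=> j' jj; rewrite vE (negPf jj) mulr0.
move=> k' kk; rewrite mxE big1 // => j' _; rewrite mxE big1 ?mul0r // => i' _.
by rewrite adjmxE vE (negPf kk) andbF conjc0 mul0r.
Qed.

(** Writing [T = B *m adjmx B] makes the map a conjugation of [X *t 1%:M] by [1%:M *t B]. *)
Lemma cpmap_tens {a b : nat} (T : 'M[R[i]]_b) : qpsd T ->
  cpmap (fun X : 'M[R[i]]_a => X *t T).
Proof.
move=> /qpsd_gram[B ->].
have c1 : cpmap (fun X : 'M[R[i]]_a => X *t (1%:M : 'M[R[i]]_b)).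
  apply: (@eq_cpmap _ _ _ _ (fun X => esym (tens1E X))).
  by apply: cpmap_sum => l; exact: cpmap_conj.
apply: (@eq_cpmap _ _ _ _ _ (cpmap_comp _ _ c1 (cpmap_conj ((1%:M : 'M[R[i]]_a) *t B)))).
move=> X; have -> : adjmx ((1%:M : 'M[R[i]]_a) *t B) = 1%:M *t adjmx B.
  by rewrite /adjmx map_mxT trmx_tens map_mx1 trmx1.
by rewrite !tensmx_mul mul1mx !mulmx1.
Qed.

End CompletePositivity.

(** * Complete positivity of exponentials by Euler products *)

Section ExponentialPositivity.
Context {R : realType}.

(** In the order of [R[i]], [0 <= z] means a zero imaginary part and a nonnegative real part; both
    conditions survive the limit. *)
Lemma ge0_normc_lim (z : nat -> R[i]) (l : R[i]) :
  normc (z n - l) @[n --> \oo] --> (0 : R) -> (forall n, 0 <= z n) -> 0 <= l.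
Proof.
move=> zl z0; rewrite lecE /=.
have z0' n : complex.Im (z n) = 0 /\ 0 <= complex.Re (z n).
  by have := z0 n; rewrite lecE /= => /andP[/eqP -> ->].
apply/andP; split.
  rewrite -normr_le0; apply: (cvgr_to_ge zl); apply: nearW => n.
  by rewrite -normrN (le_trans _ (normr_Im_le _)) // raddfB /= (z0' n).1 sub0r.
have zl' : - normc (z n - l) @[n --> \oo] --> (0 : R).
  by rewrite -oppr0; exact: cvgN.
apply: (cvgr_to_le zl'); apply: nearW => n.
have := normr_Re_le (z n - l); rewrite raddfB /= ler_norml => /andP[_ h].
by rewrite lerNl (le_trans _ h) // lerBrDr addNr (z0' n).2.
Qed.

(* [exp (t S)] is the limit of the [n]-fold iterates of [T (t / n)]. *)
Lemma cp_on_exp_superop {D : nat} (P : 'M[R[i]]_D -> Prop)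
    (S Psi : 'M[R[i]]_D -> 'M[R[i]]_D) (T : R -> 'M[R[i]]_D -> 'M[R[i]]_D) :
  linear S -> linear Psi ->
  (forall h X, P X -> P (T h X)) ->
  (forall h X, P X -> T h X = X + h%:C *: S X + (h ^+ 2)%:C *: Psi X) ->
  (forall h, 0 <= h -> cp_on P (T h)) ->
  forall t, 0 <= t -> cp_on P (exp_superop S t).
Proof.
move=> lS lPsi TP TE Tcp t t0 m Xs PXs Xs0; apply/qpsd_mxblockP => w.
(* The matrix of one step of length [t / n.+1]. It represents [T] only on [P], so [ME] carries
   membership in [P] along the iteration. *)
pose M n := 1 + (t / n.+1%:R)%:C *: lin_mx S + ((t / n.+1%:R) ^+ 2)%:C *: lin_mx Psi.
have ME n X j : P X -> vec_mx (mxvec X *m M n ^+ j) = iter j (T (t / n.+1%:R)) X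
    /\ P (iter j (T (t / n.+1%:R)) X).
  move=> PX; elim: j => [|j [IH IP]]; first by rewrite expr0 mulmx1 mxvecK.
  split; last exact: TP.
  rewrite exprSr mulmxA -[mxvec X *m _]vec_mxK IH /M.
  rewrite !mulmxDr mulmx1 -!scalemxAr (mul_mxvec_lin_mx _ _ lS) (mul_mxvec_lin_mx _ _ lPsi).
  by rewrite -!linearZ -!linearD mxvecK /= TE.
(* The quadratic form to be shown nonnegative, as a function of the matrix [E] of the superoperator.
   It is additive and bounded by [kappa * nu E], so it respects the Euler limit. *)
pose F (E : 'M[R[i]]_(D * D)) :=
  blockform (fun a b => vec_mx (mxvec (Xs a b) *m E)) w.
have FB E E' : F E - F E' = F (E - E').
  rewrite /F /blockform -sumrB; apply: eq_bigr => a _; rewrite -sumrB.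
  apply: eq_bigr => b _; rewrite mulmxBr [vec_mx (_ - _)]linearB mulmxBr mulmxBl [RHS]mxE.
  by rewrite [X in _ = _ + X]mxE.
pose kappa := \sum_a \sum_b nu (adjmx (w a)) * nu (mxvec (Xs a b)) * nu (w b).
have Fle E : normc (F E) <= kappa * nu E.
  rewrite /F /blockform (le_trans (normc_sum _ _ _ _)) // /kappa mulr_suml.
  apply: ler_sum => a _; rewrite (le_trans (normc_sum _ _ _ _)) // mulr_suml.
  apply: ler_sum => b _; rewrite (le_trans (normc_entry_le _ _ _)) //.
  rewrite (le_trans (nuM _ _)) // mulrAC ler_wpM2r ?nu_ge0 //.
  rewrite (le_trans (nuM _ _)) // -mulrA ler_wpM2l ?nu_ge0 //.
  by rewrite nu_vec_mx nuM.
apply: (@ge0_normc_lim (fun n => F (M n ^+ n.+1)) (F (expmx (t%:C *: lin_mx S)))).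
  have lim0 : kappa * nu (M n ^+ n.+1 - expmx (t%:C *: lin_mx S)) @[n --> \oo] --> (0 : R).
    by rewrite -(mulr0 kappa); apply: cvgM; [exact: cvg_cst|exact: euler_cvg].
  apply: (squeeze_cvgr _ (cvg_cst 0) lim0); apply: nearW => n.
  by rewrite normc_ge0 FB Fle.
move=> n; set h := t / n.+1%:R in ME.
have h0 : 0 <= h by rewrite divr_ge0.
have iter_cp j : qpsd (mxblock (fun a b : 'I_m => iter j (T h) (Xs a b))).
  elim: j => [//|j IH]; apply: Tcp => // a b; exact: (ME n _ j (PXs a b)).2.
have /qpsd_mxblockP/(_ w) := iter_cp n.+1.
congr (0 <= _); rewrite /F /blockform; do 2!apply: eq_bigr => ? _.
by rewrite (ME _ _ _ (PXs _ _)).1.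
Qed.

End ExponentialPositivity.

(** * The reduction [Rmap] and the injection [Jmap] *)

Section ReducedGenerator.
Context {R : rcfType}.

Lemma mxdiag_lincomb {K : nat} {p : 'I_K -> nat} (c : R[i]) (B C : forall k, 'M[R[i]]_(p k)) :
  mxdiag (fun k => c *: B k + C k) = c *: mxdiag B + mxdiag C.
Proof.
apply/mxblockP => i j; rewrite submxblockD.
have -> : submxblock (c *: mxdiag B) i j = c *: submxblock (mxdiag B) i j.
  by apply/matrixP => x y; rewrite !mxE.
have [<-|ij] := eqVneq i j; first by rewrite !submxblock_diag.
by rewrite !mxblockK (negPf ij) scaler0 addr0.
Qed.

Lemma submxblock_lincomb {K : nat} {p : 'I_K -> nat} (c : R[i])
    (X Y : 'M[R[i]]_(\sum_k p k)) i j :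
  submxblock (c *: X + Y) i j = c *: submxblock X i j + submxblock Y i j.
Proof. by apply/matrixP => x y; rewrite !mxE. Qed.

Lemma ptrace2_linear {a b : nat} : linear (@ptrace2 R a b).
Proof.
move=> c X Y; apply/matrixP => i j; rewrite !mxE mulr_sumr -big_split.
by apply: eq_bigr => l _; rewrite !mxE.
Qed.

Lemma mxtrace_ptrace2 {a b : nat} (X : 'M[R[i]]_(a * b)) : \tr (ptrace2 X) = \tr X.
Proof.
rewrite /mxtrace; under eq_bigr do rewrite mxE.
rewrite pair_big [RHS](reindex (@mxtens_index a b)) /=; last first.
  by exists (@mxtens_unindex a b) => x _; rewrite ?mxtens_indexK ?mxtens_unindexK.
by apply: eq_bigr => -[].
Qed.

Lemma ptrace2_tens {a b : nat} (X : 'M[R[i]]_a) (T : 'M[R[i]]_b) :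
  ptrace2 (X *t T) = \tr T *: X.
Proof.
apply/matrixP => i j; rewrite !mxE [RHS]mulrC mulr_sumr.
by apply: eq_bigr => l _; rewrite tensmxE.
Qed.

Lemma checkA_mxdiag {K : nat} (dF : 'I_K -> nat) (B : forall k, 'M[R[i]]_(dF k)) :
  checkA dF (mxdiag B).
Proof. by rewrite /checkA; apply: eq_mxdiag => k; rewrite submxblock_diag. Qed.

Context {K : nat} (dF dG : 'I_K -> nat).
Context (U : 'M[R[i]]_(\sum_(k < K) dF k * dG k)).
Context (tau : forall k : 'I_K, 'M[R[i]]_(dG k)).

Lemma Rmap_linear : linear (Rmap dF dG U).
Proof.
move=> c X Y; rewrite /Rmap -mxdiag_lincomb; apply: eq_mxdiag => k.
by rewrite mulmxDr mulmxDl -scalemxAr -scalemxAl submxblock_lincomb ptrace2_linear.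
Qed.

Lemma Jmap_linear : linear (Jmap dF dG U tau).
Proof.
move=> c X Y; rewrite /Jmap scalemxAl scalemxAr -mulmxDl -mulmxDr -mxdiag_lincomb.
congr (_ *m _ *m _); apply: eq_mxdiag => k; rewrite submxblock_lincomb.
by apply/matrixP => i j; rewrite !mxE mulrDl mulrA.
Qed.

Lemma cpmap_Rmap : cpmap (Rmap dF dG U).
Proof.
have cU := cpmap_conj (adjmx U); rewrite adjmxK in cU.
have cD := @cpmap_mxdiag R _ (fun k => dF k * dG k)%N dF (fun k => ptrace2)
  (fun k => cpmap_ptrace2).
exact: (cpmap_comp _ _ cU cD).
Qed.

Lemma cpmap_Jmap : (forall k, qpsd (tau k)) -> cpmap (Jmap dF dG U tau).
Proof.
move=> tau0; have cD := @cpmap_mxdiag R _ dF (fun k => dF k * dG k)%N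
  (fun k X => X *t tau k) (fun k => cpmap_tens _ (tau0 k)).
exact: (cpmap_comp _ _ cD (cpmap_conj U)).
Qed.

Lemma mxtrace_Rmap X : qunitary U -> \tr (Rmap dF dG U X) = \tr X.
Proof.
move=> [_ UU]; rewrite /Rmap mxtrace_mxdiag.
under eq_bigr do rewrite mxtrace_ptrace2.
by rewrite -mxtrace_mxblock submxblockK mxtrace_mulC mulmxA UU mul1mx.
Qed.

(** The unitaries cancel, and normalization of [tau k] makes the partial trace undo the tensor
    product in each block. *)
Lemma RmapJ Y : qunitary U -> (forall k, \tr (tau k) = 1) -> checkA dF Y ->
  Rmap dF dG U (Jmap dF dG U tau Y) = Y.
Proof.
move=> [UU _] tr1 YA; rewrite [RHS]YA /Rmap /Jmap !mulmxA UU mul1mx -mulmxA UU mulmx1.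
by apply: eq_mxdiag => k; rewrite submxblock_diag ptrace2_tens tr1 scale1r.
Qed.

End ReducedGenerator.

(** * Drift form and Kraus approximation of a Lindblad generator *)

Section Lindblad.
Context {R : rcfType} {n m : nat} (H : 'M[R[i]]_n) (hH : qhermitian H).
Context (Ls : 'I_m -> 'M[R[i]]_n).

(** This is [- 'i] times the non-Hermitian effective Hamiltonian. *)
Definition lindblad_drift : 'M[R[i]]_n :=
  (- 'i) *: H - 2^-1 *: \sum_(u < m) (adjmx (Ls u) *m Ls u).

Lemma adjmx_lindblad_drift :
  adjmx lindblad_drift = 'i *: H - 2^-1 *: \sum_(u < m) (adjmx (Ls u) *m Ls u).
Proof.
have c2 : (2^-1 : R[i])^* = 2^-1 by rewrite fmorphV rmorph_nat.
rewrite /lindblad_drift adjmxD adjmxN !adjmxZ hH adjmx_sum c2.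
have -> : conjc (- 'i : R[i]) = 'i.
  by rewrite -[LHS]/(Num.conj (- 'i)) rmorphN /= conjCi opprK.
congr (_ - _ *: _).
by apply: eq_bigr => u _; rewrite adjmxM adjmxK.
Qed.

Lemma lindblad_driftE X : lindblad H Ls X =
  lindblad_drift *m X + X *m adjmx lindblad_drift
  + \sum_(u < m) (Ls u *m X *m adjmx (Ls u)).
Proof.
rewrite adjmx_lindblad_drift /lindblad_drift /lindblad sumrB addrA addrAC; congr (_ + _).
rewrite -scaler_sumr big_split /= -mulmx_suml -mulmx_sumr.
set Q := \sum_(u < m) _.
rewrite mulmxBl mulmxBr -!scalemxAl -!scalemxAr scalerBr scalerDr opprD.
rewrite !scaleNr opprK -!addrA; congr (_ + _); exact: addrCA.
Qed.

Lemma lindblad_linear : linear (lindblad H Ls).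
Proof.
move=> c X Y; set G := lindblad_drift.
have e1 : G *m (c *: X + Y) = c *: (G *m X) + G *m Y by rewrite mulmxDr scalemxAr.
have e2 : (c *: X + Y) *m adjmx G = c *: (X *m adjmx G) + Y *m adjmx G.
  by rewrite mulmxDl scalemxAl.
have e3 : \sum_(u < m) (Ls u *m (c *: X + Y) *m adjmx (Ls u)) =
    c *: \sum_(u < m) (Ls u *m X *m adjmx (Ls u)) + \sum_(u < m) (Ls u *m Y *m adjmx (Ls u)).
  rewrite scaler_sumr -big_split; apply: eq_bigr => u _.
  by rewrite mulmxDr mulmxDl -scalemxAr -scalemxAl.
rewrite !lindblad_driftE -/G e1 e2 e3 !scalerDr [X in X + _ = _]addrACA.
exact: addrACA.
Qed.

(** By cyclicity the commutator is traceless and the jump term cancels the anticommutator. *)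
Lemma mxtrace_lindblad X : \tr (lindblad H Ls X) = 0.
Proof.
have trHX : \tr (H *m X - X *m H) = 0 by rewrite linearB /= mxtrace_mulC subrr.
rewrite /lindblad linearD linearZ /= trHX mulr0 add0r raddf_sum big1 // => u _ /=.
have t1 : \tr (Ls u *m X *m adjmx (Ls u)) = \tr (adjmx (Ls u) *m Ls u *m X).
  by rewrite mxtrace_mulC mulmxA.
have t2 := mxtrace_mulC X (adjmx (Ls u) *m Ls u).
have half (x : R[i]) : x - 2^-1 * (x + x) = 0.
  by rewrite -mulr2n -[x *+ 2]mulr_natl mulKf ?pnatr_eq0 // subrr.
by rewrite linearB linearZ /= linearD /= t1 t2; exact: half.
Qed.

(** The weight [h] of the jump part stays a scalar, so no square root enters the Kraus operators. *)
Definition lindblad_step (h : R) (X : 'M[R[i]]_n) : 'M[R[i]]_n :=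
  let V := 1%:M + h%:C *: lindblad_drift in
  V *m X *m adjmx V + h%:C *: \sum_(u < m) (Ls u *m X *m adjmx (Ls u)).

Lemma lindblad_stepE h X : lindblad_step h X =
  X + h%:C *: lindblad H Ls X
  + (h ^+ 2)%:C *: (lindblad_drift *m X *m adjmx lindblad_drift).
Proof.
rewrite /lindblad_step lindblad_driftE adjmxD adjmx1 adjmxZ conjc_real.
set G := lindblad_drift; set S := \sum_(u < m) _.
have -> : (1%:M + h%:C *: G) *m X *m (1%:M + h%:C *: adjmx G) =
    X + h%:C *: (G *m X + X *m adjmx G) + (h ^+ 2)%:C *: (G *m X *m adjmx G).
  rewrite mulmxDl mul1mx mulmxDr mulmx1 mulmxDl -!scalemxAl -!scalemxAr scalerA.
  by rewrite -rmorphM -expr2 scalerDr !addrA.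
by rewrite [in RHS]scalerDr addrAC !addrA.
Qed.

Lemma cpmap_lindblad_step h : 0 <= h -> cpmap (lindblad_step h).
Proof.
move=> h0; apply: cpmapD; first exact: cpmap_conj.
apply: cpmapZ; first by rewrite lecR.
by apply: cpmap_sum => u; exact: cpmap_conj.
Qed.

End Lindblad.

Theorem theorem4 (R : realType) (K : nat) (dF dG : 'I_K -> nat)
  (hdF : forall k, (0 < dF k)%N)
  (U : 'M[R[i]]_(\sum_(k < K) dF k * dG k)) (hU : qunitary U)
  (tau : forall k : 'I_K, 'M[R[i]]_(dG k)) (htau : forall k, full_rank_density (tau k))
  (m : nat) (H : 'M[R[i]]_(\sum_(k < K) dF k * dG k)) (hH : qhermitian H)
  (Ls : 'I_m -> 'M[R[i]]_(\sum_(k < K) dF k * dG k)) :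
  let L := lindblad H Ls in
  let Lc := fun Y => Rmap dF dG U (L (Jmap dF dG U tau Y)) in
  (forall Y, checkA dF Y -> checkA dF (Lc Y)) /\
  qds_on (checkA dF) (exp_superop Lc).
Proof.
move=> L Lc.
have tau_psd k : qpsd (tau k) by have [] := htau k.
have tau_tr k : \tr (tau k) = 1 by have [_ []] := htau k.
have LcA Y : checkA dF (Lc Y) by exact: checkA_mxdiag.
have lLc : linear Lc.
  by move=> c X Y; rewrite /Lc /L Jmap_linear lindblad_linear // Rmap_linear.
pose G := lindblad_drift H Ls.
(* The second-order remainder of the step, compressed to the reduced space. *)
pose Psi Y := Rmap dF dG U (G *m Jmap dF dG U tau Y *m adjmx G).
have lPsi : linear Psi.
  move=> c X Y; rewrite /Psi Jmap_linear mulmxDr mulmxDl -scalemxAr -scalemxAl.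
  exact: Rmap_linear.
pose T (h : R) Y := Rmap dF dG U (lindblad_step H Ls h (Jmap dF dG U tau Y)).
have RD X Y : Rmap dF dG U (X + Y) = Rmap dF dG U X + Rmap dF dG U Y.
  by have := Rmap_linear dF dG U 1 X Y; rewrite !scale1r.
have RZ c X : Rmap dF dG U (c *: X) = c *: Rmap dF dG U X.
  have R0 : Rmap dF dG U 0 = 0.
    by apply: (@addrI _ (Rmap dF dG U 0)); rewrite -RD !addr0.
  by have := Rmap_linear dF dG U c X 0; rewrite R0 !addr0.
(* Membership in [checkA] turns the zeroth-order term [Rmap] of [Jmap] into [Y] itself. *)
have TE h Y : checkA dF Y -> T h Y = Y + h%:C *: Lc Y + (h ^+ 2)%:C *: Psi Y.
  by move=> YA; rewrite /T lindblad_stepE // !RD !RZ RmapJ.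
have Tcp h : 0 <= h -> cp_on (checkA dF) (T h).
  move=> h0 p Xs _ /qpsd_mxblockP Xs0; apply/qpsd_mxblockP.
  have cJ := cpmap_Jmap dF dG U tau tau_psd.
  have cLJ := cpmap_comp _ _ cJ (cpmap_lindblad_step H Ls h h0).
  exact: (cpmap_comp _ _ cLJ (cpmap_Rmap dF dG U)).
split; first by move=> Y _; exact: LcA.
split.
- move=> t X t0 XA; apply/eqP; rewrite eq_sym -subr_eq0; apply/eqP.
  (* The off-diagonal part up to sign. It vanishes on the range of [Lc], so the exponential leaves
     it at its initial value 0. *)
  pose f (Y : 'M[R[i]]_(\sum_(k < K) dF k)) :=
    mxdiag (fun k : 'I_K => @submxblock _ K K dF dF Y k k) - Y.
  have lf : linear f.
    move=> c Y Z; rewrite /f scalerBr [RHS]addrACA -opprD -mxdiag_lincomb.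
    by congr (_ - _); apply: eq_mxdiag => k; rewrite submxblock_lincomb.
  have fA Y : checkA dF Y -> f Y = 0 by move=> YA; rewrite /f -YA subrr.
  rewrite -[LHS]/(f _) (exp_superop_invariant _ _ _ _ lLc lf) ?fA //.
  by move=> Y; exact: fA.
- by move=> X _; exact: exp_superop0.
- by move=> s t X s0 t0 _; exact: exp_superopD.
- by move=> X _; exact: exp_superop_continuous.
move=> t t0; split.
  have TA h X : checkA dF X -> checkA dF (T h X) by move=> _; exact: checkA_mxdiag.
  exact: (cp_on_exp_superop _ _ _ T lLc lPsi TA TE Tcp t t0).
move=> X _.
(* The trace is recast as a 1 by 1 matrix to fit the matrix-valued invariants of
   [exp_superop_invariant]. *)
pose f (Y : 'M[R[i]]_(\sum_(k < K) dF k)) : 'M[R[i]]_1 := (\tr Y)%:M.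
have lf : linear f by move=> c Y Z; rewrite /f linearP /= raddfD /= scale_scalar_mx.
have := exp_superop_invariant f _ t X lLc lf.
have f0 Y : f (Lc Y) = 0.
  by rewrite /f /Lc mxtrace_Rmap // mxtrace_lindblad // raddf0.
by move=> /(_ f0) /(congr1 (fun M : 'M[R[i]]_1 => M 0 0)); rewrite !mxE eqxx !mulr1n.
Qed.
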